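(* Every open convex set in a locally convex space of real dimension at least three is strongly locally multihomogeneous.
   Context: Locally convex spaces are over $\mathbb{R}$ or $\mathbb{C}$ and Hausdorff; real dimension (possibly infinite) means dimension as a real vector space. For a uniform space $X$ with uniformity $\mathcal{U}$, $U\in\mathcal{U}$ and $x\in X$, write $U(x):=\{y\in X:(x,y)\in U\}$. The uniform space $X$ is strongly locally multihomogeneous if for every $V\in\mathcal{U}$ there exists $U\in\mathcal{U}$ such that $U\subset V$ and for any integer $k\ge1$, any pairwise distinct points $a_1,\dots,a_k\in X$ and any pairwise distinct points $b_1,\dots,b_k\in X$ with $(a_j,b_j)\in U$ for all $j\in\{1,\dots,k\}$, there is a homeomorphism $h:X\to X$ satisfying: (a) $h(a_j)=b_j$ for all $j$; (b) $h(U(a_j))\subset V(a_j)$ for all $j$; (c) $h(x)=x$ for all $x\in X\setminus(U(a_1)\cup\dots\cup U(a_k))$. An open convex set $C$ in a locally convex space $X$ carries the uniformity induced by that of $X$, with basis given by the sets $\{(x,y)\in C\times C:y-x\in V\}$ as $V$ runs over the neighborhoods of $0$ in $X$. *)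

(* Defs.v *)
From HB Require Import structures.
From mathcomp Require Import all_boot all_order all_algebra.
From mathcomp Require Import all_classical all_reals all_analysis.

Set Implicit Arguments.
Unset Strict Implicit.
Unset Printing Implicit Defensive.

Import Order.TTheory GRing.Theory Num.Theory.
Import numFieldTopology.Exports.

Local Open Scope classical_set_scope.
Local Open Scope ring_scope.

(* The uniformity carried by a [tvsType] is only required to induce its
   topology, not to be translation invariant.  [tvs_sub C] is therefore a copy
   of the subtype [C], with the subspace topology, whose entourages are
   generated by the sets {(x, y) | y - x \in V} for V a neighborhood of 0. *)
Definition tvs_sub (K : numFieldType) (X : tvsType K) (C : set X) : Type :=
  set_type C.

Section TvsSub.
Local Open Scope relation_scope.
Variables (K : numFieldType) (X : tvsType K) (C : set X).

HB.instance Definition _ := Topological.copy (tvs_sub C) (set_type C).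

Definition tvs_sub_ent : set_system (tvs_sub C * tvs_sub C) :=
  filter_from (nbhs (0 : X))
    (fun V => [set xy | V (set_val xy.2 - set_val xy.1)]).

Let tvs_sub_ent_filter : Filter tvs_sub_ent.
Proof.
apply: filter_from_filter; first by exists setT; exact: filterT.
by move=> P Q nP nQ; exists (P `&` Q) => //; exact: filterI.
Qed.

Let tvs_sub_ent_refl A : tvs_sub_ent A -> diagonal `<=` A.
Proof.
move=> [V nV sVA] [x y] /diagonalP ->; apply: sVA => /=.
by rewrite subrr; exact: nbhs_singleton.
Qed.

Let tvs_sub_ent_inv A : tvs_sub_ent A -> tvs_sub_ent A^-1.
Proof.
move=> [V nV sVA]; exists (-%R @` V); first exact: nbhs0N.
move=> [x y] /= [v Vv vE]; apply: sVA => /=.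
by rewrite -opprB -vE opprK.
Qed.

Let tvs_sub_ent_split A :
  tvs_sub_ent A -> exists2 B, tvs_sub_ent B & B \; B `<=` A.
Proof.
move=> [V nV sVA].
have /= := @add_continuous X (0, 0); rewrite /continuous_at/= addr0.
move=> /(_ V nV)[/= [W1 W2] [/= nW1 nW2] Wadd].
exists [set xy : tvs_sub C * tvs_sub C |
  (W1 `&` W2) (set_val xy.2 - set_val xy.1)].
  by exists (W1 `&` W2) => //; exact: filterI.
move=> [x y] /= [z /= [_ xz] [zy _]]; apply: sVA => /=.
rewrite -[set_val y](subrK (set_val z)) -addrA.
exact: (Wadd (set_val y - set_val z, set_val z - set_val x)).
Qed.

Let tvs_sub_ent_nbhs : nbhs = nbhs_ tvs_sub_ent.
Proof.
rewrite predeq2E => x A; split.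
  move=> [_ [[G oG <-] Gx GA]].
  have nG : nbhs (set_val x) G by exact: open_nbhs_nbhs.
  exists [set xy : tvs_sub C * tvs_sub C |
      (+%R (- set_val x) @` G) (set_val xy.2 - set_val xy.1)].
    exists (+%R (- set_val x) @` G) => //.
    by rewrite -(addNr (set_val x)); exact: nbhsB.
  move=> y /xsectionP [z Gz]; rewrite [RHS]addrC => /addrI zE.
  by apply: GA; rewrite /= -zE.
move=> [W [V nV VW] WA].
have : nbhs (set_val x) (+%R (set_val x) @` V) by exact: nbhsT.
rewrite nbhsE => -[G [oG Gx] GV].
exists (set_val @^-1` G); split => //; first by exists G.
move=> y /GV [v Vv vE]; apply/WA/xsectionP/VW => /=.
by rewrite -vE addrAC subrr add0r.
Qed.

HB.instance Definition _ := Nbhs_isUniform_mixin.Build (tvs_sub C)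
  tvs_sub_ent_filter tvs_sub_ent_refl tvs_sub_ent_inv tvs_sub_ent_split
  tvs_sub_ent_nbhs.

End TvsSub.

Section RealDimension.
Variables (K : numFieldType) (X : lmodType K).

(* Over K = R or K = R[i], the scalars satisfying [Num.real] are exactly the
   real numbers, so these are bases of X regarded as a real vector space. *)
Definition real_free (B : set X) : Prop :=
  forall (s : seq X) (c : X -> K),
    uniq s -> (forall x, x \in s -> B x) -> (forall x, c x \is Num.real) ->
    \sum_(x <- s) c x *: x = 0 -> forall x, x \in s -> c x = 0.

Definition real_generating (B : set X) : Prop :=
  forall x : X, exists (s : seq X) (c : X -> K),
    [/\ forall y, y \in s -> B y, forall y, c y \is Num.real
      & x = \sum_(y <- s) c y *: y].

Definition real_basis (B : set X) : Prop := real_free B /\ real_generating B.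

Definition real_dim_ge (n : nat) : Prop :=
  exists B : set X, real_basis B /\ (`I_n #<= B)%card.

End RealDimension.

Definition homeomorphism (S T : topologicalType) (h : S -> T) : Prop :=
  exists g : T -> S,
    [/\ cancel h g, cancel g h, continuous h & continuous g].

Definition strongly_locally_multihomogeneous (X : uniformType) : Prop :=
  forall V : set (X * X), entourage V ->
  exists U : set (X * X), [/\ entourage U, U `<=` V &
    forall (k : nat) (a b : 'I_k -> X), (1 <= k)%N ->
      injective a -> injective b -> (forall j, U (a j, b j)) ->
      exists h : X -> X,
        [/\ homeomorphism h,
            forall j, h (a j) = b j,
            forall j, h @` xsection U (a j) `<=` xsection V (a j)
          & forall x, ~ (\bigcup_j xsection U (a j)) x -> h x = x]].

(* Main.v *)
(** Strong local multihomogeneity of C is obtained from two families of simultaneous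
    moves.  If a and b lie in an open convex set D, and q is the gauge of D - a, then
    q(b - a) < 1, so x |-> x + max(0, 1 - q(x - a)) (b - a) is strictly increasing along
    the direction b - a; it is a homeomorphism sending a to b and fixing the
    complement of D.  Pairwise disjoint segments have pairwise disjoint convex
    open neighborhoods, so the a_j can be moved simultaneously along disjoint
    segments.  The segments [a_j, b_j] may meet, but since the dimension is at
    least three, finitely many planes do not cover an open set, and there are
    points c_j near a_j such that the segments [a_j, c_j] are pairwise disjoint,
    as are the segments [c_j, b_j].  Every point is then displaced at most twice, by
    a bounded amount independent of k.  The complex case reduces to the real one
    by restriction of scalars. *)
Require Import Defs.
From HB Require Import structures.
From mathcomp Require Import all_boot all_order all_algebra complex ring lra.
From mathcomp Require Import all_classical all_reals all_analysis.

Set Implicit Arguments.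
Unset Strict Implicit.
Unset Printing Implicit Defensive.

Import Order.TTheory GRing.Theory Num.Theory.
Import numFieldTopology.Exports numFieldNormedType.Exports.

Local Open Scope classical_set_scope.
Local Open Scope ring_scope.

(* The square-zero extension of R by X is a commutative ring, which makes
   identities between linear combinations in X provable by [ring]. *)
Definition square_zero (R : comNzRingType) (X : lmodType R) : Type :=
  (R * X)%type.

Section SquareZero.
Variables (R : comNzRingType) (X : lmodType R).
Local Notation T := (square_zero X).

HB.instance Definition _ := GRing.Zmodule.copy T (R * X)%type.

Let one : T := (1, 0).
Let mul (p q : T) : T := (p.1 * q.1, p.1 *: q.2 + q.1 *: p.2).

Let mulA : associative mul.
Proof.
move=> [a x] [b y] [c z]; rewrite /mul /= mulrA; congr (_, _).
by rewrite !scalerDr !scalerA addrA mulrC [c * b]mulrC [c * a]mulrC.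
Qed.

Let mulC : commutative mul.
Proof. by move=> [a x] [b y]; rewrite /mul /= mulrC addrC. Qed.

Let mul1 : left_id one mul.
Proof. by move=> [a x]; rewrite /mul /= mul1r scale1r scaler0 addr0. Qed.

Let mulD : left_distributive mul +%R.
Proof.
move=> [a x] [b y] [c z]; rewrite /mul /=; congr (_, _); rewrite /=.
  by rewrite mulrDl.
by rewrite scalerDl scalerDr addrACA.
Qed.

Let one_neq0 : one != 0.
Proof. by apply/eqP => -[] /eqP; rewrite oner_eq0. Qed.

HB.instance Definition _ := GRing.Zmodule_isComNzRing.Build T
  mulA mulC mul1 mulD one_neq0.

Definition sqz_scalar (a : R) : T := (a, 0).
Definition sqz_vector (x : X) : T := (0, x).

Let scalar_additive : zmod_morphism sqz_scalar.
Proof. by move=> a b; congr (_, _); rewrite subr0. Qed.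

Let scalar_multiplicative : monoid_morphism sqz_scalar.
Proof.
by split=> // a b; congr (_, _); rewrite !scaler0 addr0.
Qed.

HB.instance Definition _ :=
  GRing.isZmodMorphism.Build R T sqz_scalar scalar_additive.
HB.instance Definition _ :=
  GRing.isMonoidMorphism.Build R T sqz_scalar scalar_multiplicative.

Lemma sqz_vector0 : sqz_vector 0 = 0. Proof. by []. Qed.

Lemma sqz_vectorN x : sqz_vector (- x) = - sqz_vector x.
Proof. by congr (_, _); rewrite oppr0. Qed.

Lemma sqz_vectorD x y : sqz_vector (x + y) = sqz_vector x + sqz_vector y.
Proof. by congr (_, _); rewrite addr0. Qed.

Lemma sqz_vectorZ a x : sqz_vector (a *: x) = sqz_scalar a * sqz_vector x.
Proof. by congr (_, _); rewrite ?mulr0// scale0r addr0. Qed.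

Lemma sqz_vector_inj : injective sqz_vector.
Proof. by move=> x y []. Qed.

Definition sqz_vectorE :=
  (sqz_vectorZ, sqz_vectorD, sqz_vectorN, sqz_vector0).

End SquareZero.

Ltac vector_ring := apply: sqz_vector_inj; rewrite ?sqz_vectorE; ring.

(** * Continuity of the module operations *)

Section TopologicalLmodule.
Variables (R : realType) (X : topologicalLmodType R).
Implicit Types (x y v : X) (t : R).

Lemma cvg_scale (T : Type) (F : set_system T) (FF : Filter F)
    (f : T -> R) (g : T -> X) t x :
  f @ F --> t -> g @ F --> x -> (fun z => f z *: g z) @ F --> t *: x.
Proof.
move=> ft gx; apply: (cvg_comp2 (h := fun (a : R^o) (b : X) => a *: b) ft gx).
exact: (@scale_continuous _ _ (t : R^o, x)).
Qed.

Lemma cvg_add (T : Type) (F : set_system T) (FF : Filter F)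
    (f g : T -> X) x y :
  f @ F --> x -> g @ F --> y -> (fun z => f z + g z) @ F --> x + y.
Proof.
move=> fx gy; apply: (cvg_comp2 (h := fun a b : X => a + b) fx gy).
exact: (@add_continuous _ (x, y)).
Qed.

Lemma cvg_opp (T : Type) (F : set_system T) (FF : Filter F) (f : T -> X) x :
  f @ F --> x -> (fun z => - f z) @ F --> - x.
Proof. by move=> fx; apply: cvg_comp fx _; exact: opp_continuous. Qed.

Lemma scaler_cvg x t : (fun s : R => s *: x) @ t --> t *: x.
Proof. by apply: cvg_scale; [exact: cvg_id|exact: cvg_cst]. Qed.

Lemma scalel_cvg t x : (fun y : X => t *: y) @ x --> t *: x.
Proof. by apply: cvg_scale; [exact: cvg_cst|exact: cvg_id]. Qed.

Lemma addl_cvg v x : (fun y => y + v) @ x --> x + v.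
Proof. by apply: cvg_add; [exact: cvg_id|exact: cvg_cst]. Qed.

Lemma near_subr (P : set X) x : nbhs 0 P -> \forall y \near x, P (y - x).
Proof. by move=> nP; have := @addl_cvg (- x) x; rewrite subrr => /(_ P nP). Qed.

Lemma near_subl (P : set X) x : nbhs 0 P -> \forall y \near x, P (x - y).
Proof.
have : (fun y => x - y) @ x --> x - x.
  by apply: cvg_add; [exact: cvg_cst|apply: cvg_opp; exact: cvg_id].
by rewrite subrr => c nP; exact: (c P nP).
Qed.

End TopologicalLmodule.

(** * Minkowski gauges of convex neighborhoods of 0 *)

Section Gauge.
Variables (R : realType) (X : topologicalLmodType R).
Implicit Types (D : set X) (x y : X) (r s t : R).

(** Convexity with a plain real coefficient, a form that convexity over [R[i]] yields after
    restriction of scalars. *)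
Definition segment_closed D :=
  forall x y t, D x -> D y -> 0 <= t -> t <= 1 -> D (t *: x + (1 - t) *: y).

Definition gauge D x : R := inf [set r | 0 < r /\ D (r^-1 *: x)].

Variable D : set X.
Hypotheses (cD : segment_closed D) (D0 : nbhs 0 D).

Let lb x : has_lbound [set r | 0 < r /\ D (r^-1 *: x)].
Proof. by exists 0 => r [/ltW]. Qed.

(** A neighborhood of 0 is absorbing: [t *: x] tends to 0 with [t], so some [t > 0] brings it into
    [D], and [t^-1] belongs to the set. *)
Lemma gauge_has_inf x : has_inf [set r | 0 < r /\ D (r^-1 *: x)].
Proof.
split; last exact: lb.
have := @scaler_cvg R X x 0 D; rewrite scale0r => /(_ D0) /= H.
have [t [t0 Dt]] : exists t, 0 < t /\ D (t *: x).
  have /nbhs_ballP[e /= e0 He] : nbhs (0 : R) (fun s => D (s *: x)) by [].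
 
  exists (e / 2); split; first lra.
  by apply: He; rewrite /ball/= sub0r normrN gtr0_norm; lra.
by exists t^-1; rewrite /= invr_gt0 invrK.
Qed.

Lemma gauge_le x r : 0 < r -> D (r^-1 *: x) -> gauge D x <= r.
Proof. by move=> r0 Dr; apply: ge_inf; [exact: lb|split]. Qed.

Lemma gauge_ge0 x : 0 <= gauge D x.
Proof.
apply: lb_le_inf; first by have [] := gauge_has_inf x.
by move=> r [/ltW].
Qed.

(** Some [s < r] has [s^-1 *: x] in [D], and [r^-1 *: x] lies on the segment from that point to
    0. *)
Lemma gauge_lt x r : gauge D x < r -> D (r^-1 *: x).
Proof.
move=> gr; have [s [s0 Ds] sr] := inf_lt (gauge_has_inf x).1 gr.
have r0 : 0 < r by exact: lt_trans sr.
have -> : r^-1 *: x = (s / r) *: (s^-1 *: x) + (1 - s / r) *: 0.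
  by rewrite scaler0 addr0 scalerA mulrAC divff ?mul1r// gt_eqF.
apply: cD => //; first exact: nbhs_singleton.
  by rewrite divr_ge0// ltW.
by rewrite ler_pdivrMr// mul1r ltW.
Qed.

(** For [r], [s] slightly above the two gauges, [(r + s)^-1 *: (x + y)] is the convex combination of
    [r^-1 *: x] and [s^-1 *: y] with weights proportional to [r] and [s]. *)
Lemma gaugeD x y : gauge D (x + y) <= gauge D x + gauge D y.
Proof.
apply/ler_addgt0Pl => e e0.
have x1 : gauge D x < gauge D x + e / 2 by lra.
have y1 : gauge D y < gauge D y + e / 2 by lra.
have := gauge_ge0 x; have := gauge_ge0 y => gy gx.
rewrite (_ : e + _ = (gauge D x + e / 2) + (gauge D y + e / 2)); last by lra.
move: (gauge_lt x1) (gauge_lt y1).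
set r := gauge D x + e / 2; set s := gauge D y + e / 2 => Dx Dy.
have r0 : 0 < r by rewrite /r; lra.
have s0 : 0 < s by rewrite /s; lra.
clearbody r s; have rs0 : r + s != 0 by rewrite gt_eqF// addr_gt0.
apply: gauge_le; first by rewrite addr_gt0.
have -> : (r + s)^-1 *: (x + y) =
    (r / (r + s)) *: (r^-1 *: x) + (1 - r / (r + s)) *: (s^-1 *: y).
  rewrite scalerDr !scalerA; congr (_ *: _ + _ *: _); field.
    by rewrite rs0 gt_eqF.
  by rewrite rs0 gt_eqF.
apply: cD => //; first by rewrite divr_ge0// ltW// addr_gt0.
rewrite ler_pdivrMr; last exact: addr_gt0.
by rewrite mul1r lerDl ltW.
Qed.

Lemma gauge0 : gauge D 0 = 0.
Proof.
apply/eqP; rewrite eq_le gauge_ge0 andbT; apply/ler_addgt0Pl => e e0.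
by rewrite addr0 gauge_le// scaler0; exact: nbhs_singleton.
Qed.

Lemma gaugeZ t x : 0 <= t -> gauge D (t *: x) <= t * gauge D x.
Proof.
rewrite le_eqVlt => /predU1P[<-|t0]; first by rewrite scale0r mul0r gauge0.
apply/ler_addgt0Pl => e e0.
have et : 0 < e / t by rewrite divr_gt0.
have x1 : gauge D x < e / t + gauge D x by lra.
rewrite (_ : e + _ = t * (e / t + gauge D x)); last by field; rewrite gt_eqF.
apply: gauge_le.
  by rewrite mulr_gt0//; have := gauge_ge0 x; lra.
have := gauge_lt x1; rewrite scalerA.
have ? : e / t + gauge D x != 0 by rewrite gt_eqF//; have := gauge_ge0 x; lra.
by rewrite invfM mulrAC mulVf ?mul1r// gt_eqF.
Qed.

Lemma gauge_near e : 0 < e -> \forall x \near 0, gauge D x <= e.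
Proof.
move=> e0; have := @scalel_cvg R X e^-1 0 D; rewrite scaler0 => /(_ D0) N.
have : nbhs (0 : X) (fun x => D (e^-1 *: x)) by [].
by apply: filterS => x; exact: gauge_le.
Qed.

(** Openness leaves room beyond [x]: a multiple of [x] by a factor above 1 is still in [D]. *)
Lemma gauge_lt1 x : open D -> D x -> gauge D x < 1.
Proof.
move=> oD Dx; have := @scaler_cvg R X x 1 D; rewrite scale1r.
move=> /(_ _) H; have /nbhs_ballP[e /= e0 He] :
    nbhs (1 : R) (fun s => D (s *: x)) by apply: H; exact: open_nbhs_nbhs.
have t0 : 0 < 1 + e / 2 by lra.
apply: (@le_lt_trans _ _ (1 + e / 2)^-1); last by rewrite invf_lt1//; lra.
apply: gauge_le; rewrite ?invr_gt0// invrK; apply: He.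
by rewrite /ball/= ltr_norml; apply/andP; split; lra.
Qed.

(** The gauge need not be symmetric, so the one-sided bound is applied in both orders; [y - x] and
    [x - y] both have small gauge near [x]. *)
Lemma lipschitz_gauge_continuous (k : R) (f : X -> R) :
  (forall x y, f x - f y <= k * gauge D (y - x)) -> continuous f.
Proof.
move=> fl x; apply/cvgrPdist_le => e e0.
(* At least [k], and positive whatever the sign of [k], so that one may divide by it. *)
pose k' := `|k| + 1.
have k'0 : 0 < k' by rewrite /k' ltr_wpDl.
have H y z : gauge D (z - y) <= e / k' -> f y - f z <= e.
  move=> yz; apply: (le_trans (fl _ _)).
  apply: (@le_trans _ _ (k' * gauge D (z - y))).
    rewrite ler_wpM2r ?gauge_ge0//; have := ler_norm k; rewrite /k'; lra.
  by rewrite -ler_pdivlMl// mulrC.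
have ek : 0 < e / k' by rewrite divr_gt0.
have N1 := near_subr x (gauge_near ek).
have N2 := near_subl x (gauge_near ek).
near=> y; rewrite ler_distlC; apply/andP; split.
  have /H : gauge D (y - x) <= e / k' by near: y.
  lra.
have /H : gauge D (x - y) <= e / k' by near: y.
lra.
Unshelve. all: by end_near. Qed.

End Gauge.

(** * Moving one point inside an open convex set *)

Section Push.
Variables (R : realType) (X : topologicalLmodType R).

(** The inverse of [x + f x *: v] is [y - psi y *: v], where [psi y] is the unique solution [s] of
    [f (y - s *: v) = s]. *)
Lemma homeomorphism_push (D : set X) (a b : X) :
  segment_closed D -> open D -> D a -> D b ->
  exists h : X -> X,
    [/\ homeomorphism h, h a = b & forall x, ~ D x -> h x = x].
Proof.
move=> cD oD Da Db.
pose E : set X := [set x | D (x + a)].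
have cE : segment_closed E.
  move=> x y t Ex Ey t0 t1; rewrite /E /=.
  rewrite (_ : _ + a = t *: (x + a) + (1 - t) *: (y + a)); first exact: cD.
  by rewrite !scalerDr addrACA -scalerDl addrC [t + _]addrC subrK scale1r addrC.
have oE : open E.
  by apply: open_comp oD => x _; exact: addl_cvg.
have E0 : nbhs 0 E by apply: open_nbhs_nbhs; split; rewrite // /E /= add0r.
pose v := b - a; pose q := gauge E.
have q_ge0 x : 0 <= q x by exact: gauge_ge0.
have qv : q v < 1 by apply: gauge_lt1 => //; rewrite /E /= subrK.
pose f x : R := Num.max 0 (1 - q (x - a)).
have f_ge0 x : 0 <= f x by rewrite le_max lexx.
have f_le1 x : f x <= 1.
  by rewrite ge_max ler01 /=; have := q_ge0 (x - a); lra.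
have f_lip x y : f x - f y <= q (y - x).
  have := gaugeD cE E0 (y - x) (x - a); rewrite addrA subrK -/q => qD.
  rewrite /f; have := q_ge0 (y - x).
  by case: (leP 0 (1 - q (x - a))); case: (leP 0 (1 - q (y - a))); lra.
have fc : continuous f.
  by apply: (lipschitz_gauge_continuous E0 (k := 1)) => x y; rewrite mul1r.
(* Since [f] takes values in [0, 1], [s - f (y - s *: v)] is at most 0 at [s = 0] and at least 0 at
   [s = 1]. *)
have fix_ex y : exists s, f (y - s *: v) = s.
  pose g s := s - f (y - s *: v).
  have gc : continuous g.
    move=> s; apply: (@cvgB _ R^o _ _ _ (fun s => s) (fun s => f (y - s *: v))).
      exact: cvg_id.
    apply: (@cvg_comp _ _ _ (fun s => y - s *: v) f _ (nbhs (y - s *: v)));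
      last exact: fc.
    apply: cvg_add; first exact: cvg_cst.
    by apply: cvg_opp; exact: scaler_cvg.
  have [|s _ gs] := @IVT R g 0 1 0 ler01 (continuous_subspaceT gc).
    rewrite ge_min le_max; apply/andP; split; apply/orP.
      by left; rewrite /g sub0r oppr_le0.
    by right; rewrite /g subr_ge0.
  by exists s; apply/esym/eqP; rewrite -subr_eq0; apply/eqP.
pose psi y : R := sval (cid (fix_ex y)).
have psiE y : f (y - psi y *: v) = psi y by exact: (svalP (cid (fix_ex y))).
pose k := (1 - q v)^-1.
(* For [s < s'], the bound on [f] and subadditivity give [s' - s <= q (y - y') + (s' - s) * q v],
   which can be solved because [q v < 1]. The case [y = y'] is uniqueness of the solution; the
   general case gives continuity of [psi]. *)
have fix_lip y y' s s' : f (y - s *: v) = s -> f (y' - s' *: v) = s' ->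
    s' - s <= k * q (y - y').
  move=> sE s'E; have k0 : 0 < k by rewrite invr_gt0; lra.
  have [ss|ss] := leP s' s.
    by apply: (@le_trans _ _ 0); [lra|apply: mulr_ge0 => //; exact: ltW].
  rewrite /k mulrC ler_pdivlMr; last lra.
  have := f_lip (y' - s' *: v) (y - s *: v); rewrite sE s'E.
  rewrite (_ : _ - _ - _ = (y - y') + (s' - s) *: v); last first.
    by rewrite scalerBl opprB [_ *: v - y']addrC addrACA [- _ + _]addrC.
  have := gaugeD cE E0 (y - y') ((s' - s) *: v).
  have /(gaugeZ cE E0 v) : 0 <= s' - s by lra.
  rewrite -/q; nra.
have psic : continuous psi.
  apply: (lipschitz_gauge_continuous E0 (k := k)) => x y.
  exact: fix_lip.
exists (fun x => x + f x *: v); split.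
- exists (fun y => y - psi y *: v); split.
  + move=> x /=; have fE : f ((x + f x *: v) - f x *: v) = f x by rewrite addrK.
    suff -> : psi (x + f x *: v) = f x by rewrite addrK.
    have := fix_lip _ _ _ _ fE (psiE (x + f x *: v)).
    have := fix_lip _ _ _ _ (psiE (x + f x *: v)) fE.
    by rewrite subrr /q (gauge0 E0) mulr0; lra.
  + by move=> y /=; rewrite psiE subrK.
  + move=> x; apply: cvg_add; first exact: cvg_id.
    by apply: cvg_scale; [exact: fc|exact: cvg_cst].
  + move=> x; apply: cvg_add; first exact: cvg_id.
    by apply: cvg_opp; apply: cvg_scale; [exact: psic|exact: cvg_cst].
- by rewrite /f subrr /q (gauge0 E0) subr0 max_r// scale1r addrC subrK.
- move=> x Dx; rewrite /f max_l ?scale0r ?addr0// subr_le0 leNgt.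
  apply: contra_notN Dx => /(gauge_lt cE E0).
  by rewrite invr1 scale1r /E /= subrK.
Qed.

End Push.

(** * Composing and gluing homeomorphisms *)

Lemma homeomorphism_id (T : topologicalType) : homeomorphism (@id T).
Proof. by exists id; split=> // x; exact: cvg_id. Qed.

Lemma homeomorphism_comp (S T U : topologicalType) (f : S -> T) (g : T -> U) :
  homeomorphism f -> homeomorphism g -> homeomorphism (g \o f).
Proof.
move=> [f' [fK f'K fc f'c]] [g' [gK g'K gc g'c]]; exists (f' \o g'); split.
- exact: can_comp.
- exact: can_comp.
- by move=> x; exact: (continuous_comp (fc _) (gc _)).
- by move=> x; exact: (continuous_comp (g'c _) (f'c _)).
Qed.

(** Were [h x] outside [D], it would be fixed, and injectivity would give [h x = x]. *)
Lemma homeomorphism_fix_setC (T : topologicalType) (h : T -> T) (D : set T) :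
  homeomorphism h -> (forall x, ~ D x -> h x = x) -> forall x, D x -> D (h x).
Proof.
move=> [g [hK _ _ _]] hD x Dx; apply: contrapT => Dhx.
by have /(can_inj hK) E := hD _ Dhx; apply: Dhx; rewrite E.
Qed.

(** The glued map is the composite of all the [h i]: each preserves its own [D i], and these are
    disjoint, so at most one factor moves a given point. *)
Lemma homeomorphism_glue (T : topologicalType) (I : finType) (D : I -> set T)
    (h : I -> T -> T) :
  (forall i j x, i != j -> D i x -> ~ D j x) ->
  (forall i, homeomorphism (h i)) ->
  (forall i x, ~ D i x -> h i x = x) ->
  exists H : T -> T, [/\ homeomorphism H,
    forall i x, D i x -> H x = h i x &
    forall x, (forall i, ~ D i x) -> H x = x].
Proof.
move=> Dd hh hD.
have hDD i := homeomorphism_fix_setC (hh i) (hD i).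
suff /(_ (enum I) (enum_uniq I)) [H [Hh HD H0]] : forall s : seq I, uniq s ->
    exists H : T -> T, [/\ homeomorphism H,
    forall i x, i \in s -> D i x -> H x = h i x &
    forall x, (forall i, i \in s -> ~ D i x) -> H x = x].
  exists H; split=> // [i x|x Dx].
    by apply: HD; rewrite mem_enum.
  by apply: H0 => i _.
elim=> [_|i s IHs /= /andP[si us]].
  by exists id; split=> //; exact: homeomorphism_id.
have [H [Hh HD H0]] := IHs us.
exists (H \o h i); split; first exact: homeomorphism_comp.
  move=> j x; rewrite inE => /predU1P[-> Dx|js Dx] /=.
    apply: H0 => i' i's; apply: Dd (hDD _ _ Dx).
    by apply: contraNneq si => ->.
  rewrite hD; first exact: HD.
  by apply: Dd Dx; apply: contraNneq si => <-.
move=> x sx /=; rewrite hD; last by apply: sx; rewrite mem_head.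
by apply: H0 => j js; apply: sx; rewrite inE js orbT.
Qed.

(** * Simultaneous moves along disjoint segments *)

Section Segments.
Variables (R : realType) (X : topologicalLmodType R).

Definition seg (a b : X) (t : R) : X := a + t *: (b - a).

Lemma seg_sub_cvg (a b c d : X) :
  continuous (fun p : R * R => seg a b p.1 - seg c d p.2).
Proof.
move=> p; apply: cvg_add; last (apply: cvg_opp).
  apply: cvg_add; first exact: cvg_cst.
  by apply: cvg_scale; [exact: cvg_fst|exact: cvg_cst].
apply: cvg_add; first exact: cvg_cst.
by apply: cvg_scale; [exact: cvg_snd|exact: cvg_cst].
Qed.

Definition locally_segment_closed :=
  forall V : set X, nbhs 0 V -> exists W : set X,
    [/\ open W, W 0, segment_closed W & W `<=` V].

Hypotheses (hX : hausdorff_space X) (lX : locally_segment_closed).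

Definition disjoint_segments (a b c d : X) :=
  forall s t, 0 <= s <= 1 -> 0 <= t <= 1 -> seg a b s <> seg c d t.

(** The differences between points of the two segments form a continuous image of the unit square,
    hence a compact set, closed in a Hausdorff space, which misses 0. *)
Lemma nbhs0_disjoint_segments (a b c d : X) : disjoint_segments a b c d ->
  \forall x \near (0 : X), forall s t, 0 <= s <= 1 -> 0 <= t <= 1 ->
    seg a b s - seg c d t <> x.
Proof.
move=> dis.
pose S := [set seg a b p.1 - seg c d p.2 | p in `[0%R, 1%R] `*` `[0%R, 1%R]].
have cS : closed S.
  apply: compact_closed => //; apply: continuous_compact.
    by apply: continuous_subspaceT; exact: seg_sub_cvg.
  by apply: compact_setX; exact: segment_compact.
have : nbhs (0 : X) (~` S).
  apply: open_nbhs_nbhs; split; first exact: closed_openC.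
  move=> [[s t] /= [s01 t01] /eqP]; rewrite subr_eq0 => /eqP.
  by move: s01 t01; rewrite !in_itv /=; exact: dis.
apply: filterS => x Sx s t s01 t01 st; apply: Sx.
by exists (s, t) => //; split; rewrite /= in_itv.
Qed.

Lemma nbhs0_sub (V : set X) : nbhs 0 V ->
  exists2 W, nbhs 0 W & forall x y, W x -> W y -> V (x - y).
Proof.
move=> nV; have := @sub_continuous X (0, 0); rewrite /continuous_at /= subrr.
move=> /(_ V nV) [[W1 W2] /= [n1 n2] W12].
exists (W1 `&` W2); first exact: filterI.
by move=> x y [x1 _] [_ y2]; exact: (W12 (x, y)).
Qed.

(** Each segment is thickened by a common convex [W], small enough to keep the thickenings disjoint,
    and one push is made in each. The last clause controls displacement: a moved point shares some
    [O i] with its image. *)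
Lemma homeomorphism_move (I : finType) (a c : I -> X) (O : I -> set X) :
  (forall i, open (O i)) -> (forall i, segment_closed (O i)) ->
  (forall i, O i (a i)) -> (forall i, O i (c i)) ->
  (forall i j, i != j -> disjoint_segments (a i) (c i) (a j) (c j)) ->
  exists h : X -> X, [/\ homeomorphism h, forall i, h (a i) = c i &
    forall x, h x = x \/ exists i, O i x /\ O i (h x)].
Proof.
move=> oO sO Oa Oc dis.
have [N nN HN] : exists2 N : set X, nbhs 0 N & forall x, N x ->
    forall i j, i != j -> forall s t, 0 <= s <= 1 -> 0 <= t <= 1 ->
    seg (a i) (c i) s - seg (a j) (c j) t <> x.
  exists [set x | forall ij : I * I, ij.1 != ij.2 ->
    forall s t, 0 <= s <= 1 -> 0 <= t <= 1 ->
    seg (a ij.1) (c ij.1) s - seg (a ij.2) (c ij.2) t <> x].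
    apply: filter_forall => -[i j] /=.
    have [->|ij] := eqVneq i j; first exact: nearW.
    by have := nbhs0_disjoint_segments (dis _ _ ij); apply: filterS => x Hx _.
  by move=> x Nx i j ij; exact: (Nx (i, j)).
have [W' nW' W'N] := nbhs0_sub nN.
have [W [oW W0 sW WW']] := lX nW'.
pose D i : set X :=
  [set x | O i x /\ exists s, 0 <= s <= 1 /\ W (x - seg (a i) (c i) s)].
have oD i : open (D i).
  apply: openI => //; rewrite openE => x [s [s01 Ws]].
  have : nbhs (x - seg (a i) (c i) s) W by exact: open_nbhs_nbhs.
  move=> /addl_cvg nx; have : \forall y \near x, W (y - seg (a i) (c i) s) by [].
  by apply: filterS => y Wy; exists s.
have sD i : segment_closed (D i).
  move=> x y t [Ox [s [s01 Ws]]] [Oy [s' [s'01 Ws']]] t0 t1.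
  split; first exact: sO.
  (* [seg] is affine in its parameter, so the new offset is the same convex combination of the two
     old offsets. *)
  exists (t * s + (1 - t) * s'); split; first by apply/andP; split; nra.
  rewrite /seg (_ : _ - _ =
    t *: (x - seg (a i) (c i) s) + (1 - t) *: (y - seg (a i) (c i) s')).
    exact: sW.
  by rewrite /seg; vector_ring.
have Da i : D i (a i).
  by split => //; exists 0; rewrite /seg scale0r addr0 subrr lexx ler01.
have Dc i : D i (c i).
  split => //; exists 1; rewrite /seg scale1r [a i + _]addrC subrK subrr.
  by rewrite lexx ler01.
have Dd i j x : i != j -> D i x -> ~ D j x.
  move=> ij [_ [s [s01 Ws]]] [_ [t [t01 Wt]]].
  (* Subtracting the two offsets of [x] cancels [x] and leaves a difference of points on the two
     segments, lying in [N]. *)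
  have := W'N _ _ (WW' _ Wt) (WW' _ Ws).
  by move=> /HN /(_ _ _ ij _ _ s01 t01); apply; vector_ring.
have /choice[h hP] i := homeomorphism_push (sD i) (oD i) (Da i) (Dc i).
have [i|i x|H [Hh HD H0]] := homeomorphism_glue (h := h) Dd.
- by have [] := hP i.
- by have [_ _] := hP i; exact.
exists H; split=> // [i|x].
  by rewrite (HD i)//; have [] := hP i.
have [[i Di]|nD] := pselect (exists i, D i x); last first.
  by left; apply: H0 => i Di; apply: nD; exists i.
right; exists i; split; first by case: Di.
rewrite (HD i)//; have [hh _ hx] := hP i.
by have [] := homeomorphism_fix_setC hh hx Di.
Qed.

End Segments.

(** * General position with respect to planes *)

Section Planes.
Variables (R : realType) (X : topologicalLmodType R).

Definition plane (x u v : X) : set X :=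
  [set y | exists s t : R, y = x + s *: u + t *: v].

Definition independent3 (e0 e1 e2 : X) := forall c0 c1 c2 : R,
  c0 *: e0 + c1 *: e1 + c2 *: e2 = 0 -> [/\ c0 = 0, c1 = 0 & c2 = 0].

(** Otherwise [e_i = a_i *: u + b_i *: v]. The 2 by 2 minors of the coefficients give a relation
    among the [e_i], so they vanish; the vanishing of the last one gives two relations between [e0]
    and [e1], which force [e0 = 0]. *)
Lemma independent3_notin_span (e0 e1 e2 u v : X) : independent3 e0 e1 e2 ->
  exists w, ~ plane 0 u v w.
Proof.
move=> ind; apply: contrapT => /forallNP H.
have /contrapT[a0 [b0 E0]] := H e0.
have /contrapT[a1 [b1 E1]] := H e1.
have /contrapT[a2 [b2 E2]] := H e2.
have [] := ind (a1 * b2 - a2 * b1) (a2 * b0 - a0 * b2) (a0 * b1 - a1 * b0).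
  by rewrite E0 E1 E2; vector_ring.
move=> m0 m1 m2.
have [|b1_0 b0_0 _] := ind b1 (- b0) 0.
  transitivity ((a0 * b1 - a1 * b0) *: u); last by rewrite m2 scale0r.
  by rewrite E0 E1; vector_ring.
have [|a1_0 a0_0 _] := ind a1 (- a0) 0.
  transitivity (- (a0 * b1 - a1 * b0) *: v); last by rewrite m2 oppr0 scale0r.
  by rewrite E0 E1; vector_ring.
have [] := ind 1 0 0; last by move=> /eqP; rewrite oner_eq0.
move: b0_0 a0_0 => /eqP; rewrite oppr_eq0 => /eqP b0_0.
move=> /eqP; rewrite oppr_eq0 => /eqP a0_0.
by rewrite E0 a0_0 b0_0; vector_ring.
Qed.

(** Two hits of the line [z + t *: w] would put [w] in the span of [u], [v] and [z] in the plane. So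
    there is at most one hit, and small positive [t] avoid it. *)
Lemma near_notin_plane (x u v z w : X) :
  ~ plane x u v z \/ ~ plane 0 u v w ->
  \forall t \near (0 : R)^'+, ~ plane x u v (z + t *: w).
Proof.
move=> zw.
have [[t0 [t0_gt0 [s0 [r0 E0]]]]|none] :=
    pselect (exists t0, 0 < t0 /\ plane x u v (z + t0 *: w)); last first.
  have := nbhs_right_gt (0 : R).
  by apply: filterS => t t_gt0 Pt; apply: none; exists t.
have := nbhs_right_lt t0_gt0; apply: filterS => t tt0 [s1 [r1 E1]].
have d0 : (t0 - t)^-1 * (t0 - t) = 1 by rewrite mulVf// subr_eq0 gt_eqF.
pose k := (t0 - t)^-1.
have wE : w = (k * (s0 - s1)) *: u + (k * (r0 - r1)) *: v.
  have -> : w = k *: ((z + t0 *: w) - (z + t *: w)).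
    by rewrite -[LHS]scale1r -d0 /k; vector_ring.
  by rewrite E0 E1; vector_ring.
case: zw => [zP|wP].
  apply: zP; exists (s1 - t * (k * (s0 - s1))), (r1 - t * (k * (r0 - r1))).
  rewrite -[z](addrK (t *: w)) E1 {1}wE; vector_ring.
by apply: wP; exists (k * (s0 - s1)), (k * (r0 - r1)); rewrite add0r.
Qed.

(** Planes are avoided one at a time. If the current [y] lies on the next plane, it is shifted
    slightly in a direction outside the span of that plane, which preserves membership in [O] and
    avoidance of the earlier planes. *)
Lemma open_avoid_planes (e0 e1 e2 : X) (J : finType) (x u v : J -> X)
    (O : set X) (z : X) :
  independent3 e0 e1 e2 -> open O -> O z ->
  exists y, O y /\ forall j, ~ plane (x j) (u j) (v j) y.
Proof.
move=> ind oO Oz.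
suff /(_ (enum J)) [y [Oy Py]] : forall s : seq J, exists y,
    O y /\ forall j, j \in s -> ~ plane (x j) (u j) (v j) y.
  by exists y; split => // j; apply: Py; rewrite mem_enum.
elim=> [|i s [y [Oy Py]]]; first by exists z.
have [Pi|nPi] := pselect (plane (x i) (u i) (v i) y); last first.
  by exists y; split => // j; rewrite inE => /predU1P[->//|]; exact: Py.
have [w wP] := independent3_notin_span (u i) (v i) ind.
have nO : \forall t \near (0 : R)^'+, O (y + t *: w).
  have c : (fun t : R => y + t *: w) @ (0 : R) --> y + 0 *: w.
    by apply: cvg_add; [exact: cvg_cst|exact: scaler_cvg].
  have : nbhs (0 : R) (fun t => O (y + t *: w)).
    by apply: c; rewrite scale0r addr0; exact: open_nbhs_nbhs.
  by rewrite /at_right /within /=; apply: filterS.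
have nP : \forall t \near (0 : R)^'+, forall j : J, j \in i :: s ->
    ~ plane (x j) (u j) (v j) (y + t *: w).
  apply: filter_forall => j.
  have [js|js] := boolP (j \in i :: s); last exact: nearW.
  have : ~ plane (x j) (u j) (v j) y \/ ~ plane 0 (u j) (v j) w.
    by move: js; rewrite inE => /predU1P[->|/Py]; [right|left].
  by move=> /near_notin_plane; apply: filterS.
have [t [Ot Pt]] := filter_ex (filterI nO nP).
by exists (y + t *: w).
Qed.

Lemma disjoint_segments_sym (a b c d : X) :
  disjoint_segments a b c d -> disjoint_segments c d a b.
Proof. by move=> H s t s01 t01 /esym; exact: H. Qed.

Lemma disjoint_segments_rev (a b c d : X) :
  disjoint_segments a b c d -> disjoint_segments b a d c.
Proof.
move=> H s t s01 t01; have := H (1 - s) (1 - t).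
have -> : seg b a s = seg a b (1 - s) by rewrite /seg; vector_ring.
have -> : seg d c t = seg c d (1 - t) by rewrite /seg; vector_ring.
by apply; lra.
Qed.

(** The first exclusion concerns the line through [a] and [c], the second the plane through [a],
    [c], [d]. A common point with [s != 0] expresses [b] in that plane; with [s = 0] it puts [d] on
    that line. *)
Lemma disjoint_segments_notin_plane (a b c d : X) :
  a <> c -> ~ plane c (a - c) 0 d -> ~ plane a (c - a) (d - a) b ->
  disjoint_segments a b c d.
Proof.
move=> ac dP bP s t _ _; rewrite /seg => st.
have [s0|s0] := eqVneq s 0.
  move: st; rewrite s0 scale0r addr0 => st.
  have [t0|t0] := eqVneq t 0.
    by apply: ac; rewrite st t0 scale0r addr0.
  apply: dP; exists t^-1, 0.
  rewrite {1}st scaler0 addr0 [c + _ - c]addrC addKr scalerA mulVf// scale1r.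
  by rewrite addrC subrK.
apply: bP; exists (s^-1 * (1 - t)), (s^-1 * t).
have -> : b = a + s^-1 *: ((a + s *: (b - a)) - a).
  rewrite [a + _ - a]addrC addKr scalerA mulVf// scale1r.
  by rewrite addrC subrK.
by rewrite st; vector_ring.
Qed.

Lemma generic_midpoints (e0 e1 e2 : X) (I : finType) (a b : I -> X)
    (O : I -> set X) :
  independent3 e0 e1 e2 -> injective a -> injective b ->
  (forall i, open (O i)) -> (forall i, O i (a i)) ->
  exists c : I -> X, [/\ forall i, O i (c i),
    forall i j, i != j -> disjoint_segments (a i) (c i) (a j) (c j) &
    forall i j, i != j -> disjoint_segments (c i) (b i) (c j) (b j)].
Proof.
move=> ind ia ib oO Oa.
(* The middle clause ranges over all [j], including indices treated later: it keeps [c i] off the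
   lines from which later segments will start. *)
suff /(_ (enum I)) [c [Oc _ cab]] : forall s : seq I, exists c : I -> X,
    [/\ forall i, i \in s -> O i (c i),
        forall i j, i \in s -> ~ plane (a i) (a j - a i) 0 (c i) /\
                               ~ plane (b i) (b j - b i) 0 (c i) &
        forall i j, i \in s -> j \in s -> i != j ->
          disjoint_segments (a i) (c i) (a j) (c j) /\
          disjoint_segments (b i) (c i) (b j) (c j)].
  exists c; split=> [i|i j ij|i j ij]; first by apply: Oc; rewrite mem_enum.
    by have [] := cab _ _ (mem_enum _ i) (mem_enum _ j) ij.
  apply: disjoint_segments_rev.
  by have [] := cab _ _ (mem_enum _ i) (mem_enum _ j) ij.
elim=> [|i s [c [Oc lc cab]]]; first by exists a.
have [is_|is_] := boolP (i \in s).
  have E j : (j \in i :: s) = (j \in s).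
    by rewrite inE; case: eqVneq => [->|].
  by exists c; split=> [j|j l|j l]; rewrite ?E; [exact: Oc|exact: lc|exact: cab].
(* The new point must avoid, for every [j], the plane through [a i], [a j], [c j] and the one
   through [b i], [b j], [c j]; the boolean selects the family. These planes contain the lines of
   the middle clause. *)
pose p (d : bool) := if d then a else b.
have [y [Oy Py]] := @open_avoid_planes e0 e1 e2 (I * bool)%type
  (fun q => p q.2 i) (fun q => p q.2 q.1 - p q.2 i) (fun q => c q.1 - p q.2 i)
  _ _ ind (oO i) (Oa i).
pose c' j := if j == i then y else c j.
have c'i : c' i = y by rewrite /c' eqxx.
have c's j : j \in s -> c' j = c j.
  by rewrite /c'; case: eqVneq => // -> is'; rewrite is' in is_.
have yl j : ~ plane (a i) (a j - a i) 0 y /\ ~ plane (b i) (b j - b i) 0 y.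
  split=> -[t [t' yE]].
    by apply: (Py (j, true)); exists t, 0; rewrite yE scaler0 scale0r.
  by apply: (Py (j, false)); exists t, 0; rewrite yE scaler0 scale0r.
have dis j : j \in s -> disjoint_segments (a i) y (a j) (c j) /\
    disjoint_segments (b i) y (b j) (c j).
  move=> js; have [la lb] := lc j i js.
  have ij : i <> j by move=> ij; rewrite ij js in is_.
  split; apply: disjoint_segments_notin_plane => //.
  - by move/ia.
  - exact: (Py (j, true)).
  - by move/ib.
  - exact: (Py (j, false)).
exists c'; split=> [j|j l|j l]; rewrite inE => /predU1P[->|js].
- by rewrite c'i.
- by rewrite c's//; exact: Oc.
- by rewrite c'i.
- by rewrite c's//; exact: lc.
- rewrite inE => /predU1P[->|ls]; first by rewrite eqxx.
  by move=> _; rewrite c'i c's//; exact: dis.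
- rewrite inE => /predU1P[->|ls] jl.
    rewrite c'i c's//; have [d1 d2] := dis _ js.
    by split; exact: disjoint_segments_sym.
  by rewrite !c's//; exact: cab.
Qed.

End Planes.

(* Strong local multihomogeneity of C, phrased without scalars and with
   homeomorphisms of the ambient space that are the identity off C. *)
Definition ambient_multihomogeneous (X : topologicalZmodType) (C : set X) :=
  forall V : set X, nbhs 0 V -> exists U : set X, [/\ nbhs 0 U, U `<=` V &
    forall (k : nat) (a b : 'I_k -> X), injective a -> injective b ->
      (forall j, C (a j)) -> (forall j, C (b j)) ->
      (forall j, U (b j - a j)) ->
      exists h : X -> X, [/\ homeomorphism h, forall j, h (a j) = b j,
        forall j x, U (x - a j) -> V (h x - a j),
        forall x, (forall j, ~ U (x - a j)) -> h x = x &
        forall x, ~ C x -> h x = x]].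

(** The homeomorphism is a move from [a] to [c] followed by one from [c] to [b], both supported in
    the convex sets [O j]. *)
Lemma ambient_multihomogeneous_convex (R : realType)
    (X : topologicalLmodType R) (C : set X) (e0 e1 e2 : X) :
  hausdorff_space X -> locally_segment_closed X -> independent3 e0 e1 e2 ->
  open C -> segment_closed C -> ambient_multihomogeneous C.
Proof.
move=> hX lX ind oC sC V nV.
(* [W3] makes the displacement of one move lie in [W2]; [W2] and [W1] then absorb the first and the
   second displacement, so that a point of [a j + W] ends in [a j + V]. *)
have [W1 nW1 W1V] := nbhs0_sub nV.
have [W2 nW2 W21] := nbhs0_sub nW1.
have [W3 nW3 W32] := nbhs0_sub nW2.
have [W [oW W0 sW WW3]] := lX _ nW3.
have sub21 : W2 `<=` W1.
  by move=> x W2x; rewrite -[x]subr0; apply: W21 (nbhs_singleton nW2).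
have sub2 : W `<=` W2.
  move=> x /WW3 W3x; rewrite -[x]subr0.
  exact: W32 (nbhs_singleton nW3).
exists W; split; first exact: open_nbhs_nbhs.
  move=> x /sub2/sub21 W1x; rewrite -[x]subr0.
  exact: W1V (nbhs_singleton nW1).
move=> k a b ia ib Ca Cb Wab.
pose O j : set X := C `&` [set x | W (x - a j)].
have oO j : open (O j).
  by apply: openI => //; apply: open_comp oW => x _; exact: addl_cvg.
have sO j : segment_closed (O j).
  move=> x y t [Cx Wx] [Cy Wy] t0 t1; split; first exact: sC.
  rewrite /= (_ : _ - a j = t *: (x - a j) + (1 - t) *: (y - a j)).
    exact: sW.
  by vector_ring.
have Oa j : O j (a j) by split => //=; rewrite subrr.
have Ob j : O j (b j) by split; [exact: Cb|exact: Wab].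
have [c [Oc dac dcb]] := generic_midpoints ind ia ib oO Oa.
have [h1 [hh1 h1a h1O]] := homeomorphism_move hX lX oO sO Oa Oc dac.
have [h2 [hh2 h2c h2O]] := homeomorphism_move hX lX oO sO Oc Ob dcb.
have hW (h : X -> X) : (forall x, h x = x \/ exists i, O i x /\ O i (h x)) ->
    forall x, W2 (x - h x).
  move=> hO x; have [->|[i [[_ Wx] [_ Whx]]]] := hO x.
    by rewrite subrr; exact: nbhs_singleton.
  rewrite (_ : x - h x = (x - a i) - (h x - a i)).
    by apply: W32; exact: WW3.
  by rewrite opprB addrA subrK.
(* A point outside [P] is in no [O i], so both moves fix it. This serves for [P] the union of the
   translates of [W] and for [P = C]. *)
have hfix (P : set X) (x : X) : (forall i, O i x -> P x) -> ~ P x ->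
    (h2 \o h1) x = x.
  move=> OP Px /=.
  have -> : h1 x = x by have [//|[i [/OP]]] := h1O x.
  by have [//|[i [/OP]]] := h2O x.
exists (h2 \o h1); split.
- exact: homeomorphism_comp.
- by move=> j /=; rewrite h1a h2c.
- move=> j x Wx /=.
  rewrite (_ : _ - a j =
    ((x - a j) - (x - h1 x)) - (h1 x - h2 (h1 x))).
    apply: W1V; last by apply: sub21; exact: hW.
    by apply: W21; [exact: sub2|exact: hW].
  by vector_ring.
- move=> x Wx; apply: (hfix [set x | exists j, W (x - a j)]).
    by move=> i [_ ?]; exists i.
  by move=> [j]; exact: Wx.
- by move=> x Cx; apply: (hfix C) => // i [].
Qed.

(** * Passage from the ambient space to the subspace [C] *)

Section Restriction.
Variables (K : numFieldType) (X : tvsType K) (C : set X).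

(** Both [h] and its inverse are the identity off [C], so both map [C] into itself; the induced maps
    are continuous because the subspace topology is initial for [set_val]. *)
Lemma homeomorphism_restrict (h : X -> X) : homeomorphism h ->
  (forall x, ~ C x -> h x = x) ->
  exists2 h' : tvs_sub C -> tvs_sub C, homeomorphism h' &
    forall x, set_val (h' x) = h (set_val x).
Proof.
move=> hh hC; have CC := homeomorphism_fix_setC hh hC.
have [g [hK gK hc gc]] := hh.
have gC x : ~ C x -> g x = x by move=> /hC E; rewrite -{1}E hK.
have gCC : forall x, C x -> C (g x).
  by apply: homeomorphism_fix_setC gC; exists h.
have restr (f : X -> X) : continuous f -> (forall x, C x -> C (f x)) ->
    exists2 f' : tvs_sub C -> tvs_sub C, continuous f' &
      forall x, set_val (f' x) = f (set_val x).
  move=> fc fC.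
  exists (fun x : tvs_sub C =>
    SigSub (mem_set (fC _ (set_valP (x : set_type C)))) : set_type C) => //.
  apply: (@continuous_comp_initial (set_type C) (tvs_sub C) X set_val) => x.
  apply: (@continuous_comp (tvs_sub C) X X set_val f); last exact: fc.
  exact: (@initial_continuous (set_type C) X set_val).
have [h' h'c h'E] := restr h hc CC; have [g' g'c g'E] := restr g gc gCC.
exists h' => //; exists g'; split=> // x; apply: val_inj.
  by rewrite -set_valE g'E h'E hK.
by rewrite -set_valE h'E g'E gK.
Qed.

Lemma tvs_sub_multihomogeneous : ambient_multihomogeneous C ->
  strongly_locally_multihomogeneous (tvs_sub C).
Proof.
move=> HC V [V0 nV0 V0V]; have [U0 [nU0 U0V0 H]] := HC _ nV0.
exists [set xy | U0 (set_val xy.2 - set_val xy.1)]; split.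
- by exists U0.
- by move=> xy /U0V0 /V0V.
move=> k a b _ ia ib Uab.
have CA (x : tvs_sub C) : C (set_val x) by exact: (set_valP (x : set_type C)).
have [h [hh hab hV hU hC]] := H k (set_val \o a) (set_val \o b)
  (inj_comp val_inj ia) (inj_comp val_inj ib) (fun j => CA (a j))
  (fun j => CA (b j)) Uab.
have [h' hh' h'E] := homeomorphism_restrict hh hC.
exists h'; split=> //.
- by move=> j; apply: val_inj; rewrite -set_valE h'E hab.
- move=> j _ [x /xsectionP /= Ux <-]; apply/xsectionP/V0V => /=.
  by rewrite h'E; exact: hV.
- move=> x nU; apply: val_inj; rewrite -set_valE h'E hU// => j Ux.
  by apply: nU; exists j => //; apply/xsectionP.
Qed.

Lemma real_dim_ge3_independent : real_dim_ge X 3 -> exists e0 e1 e2 : X,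
  forall c0 c1 c2 : K, c0 \is Num.real -> c1 \is Num.real ->
    c2 \is Num.real -> c0 *: e0 + c1 *: e1 + c2 *: e2 = 0 ->
    [/\ c0 = 0, c1 = 0 & c2 = 0].
Proof.
move=> [B [[Bfree _] /card_leP[f]]].
pose e (i : 'I_3) : X := set_val (f (ordII i)).
have Be i : B (e i) by exact: set_valP.
have ie : injective e.
  move=> i j /val_inj fij; apply: (can_inj (@ordIIK _)).
  by apply: (inj _ _ fij); rewrite in_setT.
pose i0 : 'I_3 := inord 0; pose i1 : 'I_3 := inord 1; pose i2 : 'I_3 := inord 2.
have n01 : e i0 != e i1 by rewrite (inj_eq ie) -val_eqE /= !inordK.
have n02 : e i0 != e i2 by rewrite (inj_eq ie) -val_eqE /= !inordK.
have n12 : e i1 != e i2 by rewrite (inj_eq ie) -val_eqE /= !inordK.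
exists (e i0), (e i1), (e i2) => c0 c1 c2 r0 r1 r2 sum0.
(* [real_free] takes coefficients as a function of the vector; this one is consistent because the
   three vectors are distinct. *)
pose c x := if x == e i0 then c0 else if x == e i1 then c1 else c2.
have E0 : c (e i0) = c0 by rewrite /c eqxx.
have E1 : c (e i1) = c1 by rewrite /c eqxx eq_sym (negPf n01).
have E2 : c (e i2) = c2.
  by rewrite /c eq_sym (negPf n02) eq_sym (negPf n12).
have := Bfree [:: e i0; e i1; e i2] c; rewrite /= !inE !negb_or n01 n02 n12 /=.
move=> /(_ isT) Hc; rewrite -E0 -E1 -E2.
have {}Hc : forall x, x \in [:: e i0; e i1; e i2] -> c x = 0.
  apply: Hc => [x||].
  - by rewrite !inE => /or3P[] /eqP ->.
  - by move=> x; rewrite /c; case: ifP => // _; case: ifP.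
  - by rewrite !big_cons big_nil addr0 addrA E0 E1 E2.
by split; apply: Hc; rewrite !inE eqxx ?orbT.
Qed.

End Restriction.

(** * Convexity and restriction of scalars *)

Lemma convex_setP (K : numDomainType) (X : lmodType K) (A : set X) :
  convex_set A -> forall x y t, A x -> A y -> 0 <= t -> t <= 1 ->
  A (t *: x + (1 - t) *: y).
Proof.
move=> cA x y t Ax Ay t0 t1.
by have := cA x y (Itv01 t0 t1) (mem_set Ax) (mem_set Ay); rewrite inE.
Qed.

Lemma nbhs0_convex (K : numFieldType) (X : tvsType K) (V : set X) :
  nbhs 0 V -> exists W : set X, [/\ open W, W 0, convex_set W & W `<=` V].
Proof.
have [B cB [oB BV]] := @locally_convex K X.
move=> /BV [W [BW W0] WV]; exists W; split=> //; first exact: oB.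
by apply: cB; exact: mem_set.
Qed.

Lemma real_complex_continuous (R : realType) :
  continuous (fun r : R => r%:C%C : R[i]^o).
Proof.
move=> r; apply/(@cvgrPdist_lt _ R[i]^o) => e e0.
(* A positive element of [R[i]] is real, so the radius comes from some [d] in [R]. *)
have /complex_realP[d dE] := gtr0_real e0.
have d0 : 0 < d by rewrite -ltcR -dE.
have := nbhsx_ballx r _ d0.
apply: filterS => s rs; rewrite dE -rmorphB normc_def /=.
by rewrite expr0n addr0 sqrtr_sqr ltcR.
Qed.

Section Realified.
Variables (R : realType) (X : tvsType R[i]).
Local Open Scope complex_scope.

(** A separate name for [X], so that the real scaling does not clash with the complex one while
    topology and addition are shared. *)
Definition realified : Type := X.

HB.instance Definition _ := TopologicalZmodule.copy realified X.

Let scale (r : R) (x : realified) : realified := r%:C *: (x : X).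

Let scaleA a b x : scale a (scale b x) = scale (a * b) x.
Proof. by rewrite /scale scalerA -rmorphM. Qed.

Let scale1 : left_id 1 scale.
Proof. by move=> x; rewrite /scale rmorph1 scale1r. Qed.

Let scaleDr : right_distributive scale +%R.
Proof. by move=> r x y; rewrite /scale scalerDr. Qed.

Let scaleDl x : {morph scale^~ x : a b / a + b}.
Proof. by move=> a b; rewrite /scale rmorphD scalerDl. Qed.

HB.instance Definition _ := GRing.Zmodule_isLmodule.Build R realified
  scaleA scale1 scaleDr scaleDl.

Let scale_cont : continuous (fun z : R^o * realified => z.1 *: z.2).
Proof.
move=> [r x].
have fc : (fun z : R^o * realified => z.1%:C : R[i]^o) @ (r : R^o, x) -->
    (r%:C : R[i]^o).
  by apply: cvg_comp; [exact: cvg_fst|exact: real_complex_continuous].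
have gc : (fun z : R^o * realified => z.2 : X) @ (r : R^o, x) --> (x : X).
  exact: cvg_snd.
apply: (cvg_comp2 (h := fun (a : R[i]^o) (b : X) => a *: b) fc gc).
exact: (@scale_continuous _ X (r%:C : R[i]^o, x : X)).
Qed.

HB.instance Definition _ :=
  TopologicalZmodule_isTopologicalLmodule.Build R realified scale_cont.

End Realified.

Theorem theorem18 (R : realType) :
  (forall (X : tvsType R) (C : set X),
     hausdorff_space X -> real_dim_ge X 3 -> open C -> convex_set C ->
     strongly_locally_multihomogeneous (tvs_sub C)) /\
  (forall (X : tvsType R[i]) (C : set X),
     hausdorff_space X -> real_dim_ge X 3 -> open C -> convex_set C ->
     strongly_locally_multihomogeneous (tvs_sub C)).
Proof.
split=> X C hX /real_dim_ge3_independent[e0 [e1 [e2 ind]]] oC cC.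
- apply: tvs_sub_multihomogeneous.
  apply: (@ambient_multihomogeneous_convex R X C e0 e1 e2) => //.
  + move=> V /nbhs0_convex[W [oW W0 cW WV]]; exists W; split=> //.
    exact: convex_setP.
  + by move=> c0 c1 c2; apply: ind; exact: num_real.
  + exact: convex_setP.
- apply: tvs_sub_multihomogeneous.
  (* The order of [R[i]] restricts to that of [R], so real coefficients in [0, 1] are admissible in
     complex convexity. *)
  have real_convex (A : set X) : convex_set A ->
      segment_closed (A : set (realified X)).
    move=> cA x y t Ax Ay t0 t1.
    have := convex_setP cA (t := t%:C%C) Ax Ay.
    rewrite -[0 in X in X -> _]/(0%:C)%C -[1 in X in _ -> X -> _]/(1%:C)%C.
    by rewrite !lecR -rmorphB; apply.
  apply: (@ambient_multihomogeneous_convex R (realified X) C e0 e1 e2) => //.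
  + move=> V /nbhs0_convex[W [oW W0 cW WV]]; exists W; split=> //.
    exact: real_convex.
  + move=> c0 c1 c2 E.
    (* Independence in [X] was obtained for real coefficients only, and those of [realified X] embed
       as such. *)
    have rC (r : R) : r%:C%C \is Num.real by apply/complex_realP; exists r.
    have [[] ? [] ? [] ?] := ind _ _ _ (rC c0) (rC c1) (rC c2) E.
    by split.
  + exact: real_convex.
Qed.
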